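(* Let $r\ge 2$ and $k\ge 3$ be integers and let $n_r\ge n_{r-1}\ge\cdots\ge n_1\ge 2k-1$. Then $$ar_r(\mathcal{K}_{n_1,\ldots,n_r},M_k)=(k-2)n_2\cdots n_r+1.$$ Moreover, every edge-coloring of $\mathcal{K}_{n_1,\ldots,n_r}$ with exactly $(k-2)n_2\cdots n_r+1$ colors that is not a coloring of type $\phi_r$ contains a rainbow $k$-matching.
   Context: For disjoint vertex sets $V_1,\ldots,V_r$ with $|V_i|=n_i$, the complete $r$-partite $r$-uniform hypergraph $\mathcal{K}_{n_1,\ldots,n_r}$ has vertex set $V_1\cup\cdots\cup V_r$ and edge set all $r$-element sets $S$ with $|S\cap V_i|=1$ for every $i$. A $k$-matching $M_k$ is a set of $k$ pairwise disjoint edges. An edge-colored hypergraph is rainbow if all its edges have distinct colors. $ar_r(\mathcal{G},\mathcal{H})$ denotes the maximum number of colors in an edge-coloring of $\mathcal{G}$ containing no rainbow copy of $\mathcal{H}$. A coloring of type $\phi_r$ is obtained as follows: take a subhypergraph $\mathcal{K}_{k-2,n_2,\ldots,n_r}$ of $\mathcal{K}_{n_1,\ldots,n_r}$ (i.e. the edges meeting a fixed $(k-2)$-subset of $V_1$), color its edges with pairwise distinct colors, and color all remaining edges with one further new color; this uses $(k-2)n_2\cdots n_r+1$ colors.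
   Formalization: In a coloring of type φ_r the (k-2)-subset may lie in any part of minimum size n_1, not only in V_1; with V_1 alone the ''moreover'' claim fails when n_1=n_2 (use a (k-2)-subset of V_2 instead). *)

(* Defs.v *)
From mathcomp Require Import all_boot.

Set Implicit Arguments.
Unset Strict Implicit.
Unset Printing Implicit Defensive.

(* A hypergraph is given by its edge set. An edge-coloring is a map to nat of
   which only the values on the edges matter. *)

Section Hypergraphs.

Variable T : finType.

Definition pairwise_disjoint (r : nat) (V : 'I_r -> {set T}) : Prop :=
  forall i j : 'I_r, i != j -> [disjoint V i & V j].

(* [complete_partite V] lies on the union of the V i: if S has r elements and
   meets each of the r disjoint parts in one, then S is inside the union. *)
Definition complete_partite (r : nat) (V : 'I_r -> {set T}) : {set {set T}} :=
  [set S : {set T} | (#|S| == r) && [forall i, #|S :&: V i| == 1]].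

Definition matching (k : nat) (M : {set {set T}}) : Prop :=
  #|M| = k /\ trivIset M.

Definition rainbow (c : {set T} -> nat) (M : {set {set T}}) : Prop :=
  {in M &, injective c}.

Definition n_colors (G : {set {set T}}) (c : {set T} -> nat) : nat :=
  size (undup [seq c e | e in G]).

(* [H M] says that the edge set M forms a copy of the hypergraph sought. *)
Definition has_rainbow (G : {set {set T}}) (H : {set {set T}} -> Prop)
    (c : {set T} -> nat) : Prop :=
  exists M : {set {set T}}, [/\ M \subset G, H M & rainbow c M].

(* ar(G, H) = m, i.e. m is the maximum of the numbers of colors of the
   edge-colorings of G without a rainbow copy of H. *)
Definition is_ar (G : {set {set T}}) (H : {set {set T}} -> Prop)
    (m : nat) : Prop :=
  (exists c : {set T} -> nat, n_colors G c = m /\ ~ has_rainbow G H c) /\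
  (forall c : {set T} -> nat, ~ has_rainbow G H c -> n_colors G c <= m).

(* The parts W i of the sub-hypergraph K_{k-2, n_2, ..., n_r} are not required
   to satisfy W i \subset V i: if several parts V i have the minimal size n_1,
   the part of size k - 2 may be taken in any of them. If n_1 < n_2, inclusion
   of the edge sets forces W 0 \subset V 0 and that the sub-hypergraph consists
   of the edges meeting W 0 (for 2 < k). *)
Definition type_phi (r k : nat) (V : 'I_r -> {set T})
    (c : {set T} -> nat) : Prop :=
  exists W : 'I_r -> {set T},
    [/\ pairwise_disjoint W,
        forall i : 'I_r, #|W i| = if val i == 0 then k - 2 else #|V i|,
        complete_partite W \subset complete_partite V,
        rainbow c (complete_partite W) &
        exists a : nat,
          (forall e, e \in complete_partite W -> c e <> a) /\
          (forall e, e \in complete_partite V :\: complete_partite W ->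
             c e = a)].

End Hypergraphs.

(* Main.v *)
Require Import Defs.
From mathcomp Require Import all_boot all_fingroup zify.

(** Write edges as choice functions f with f i in V i, and let n_i = #|V i|,
    with parts indexed from 0. Tie the coordinates s, s+1, ... of f to f 0 by
    injections V 0 -> V i: this gives a slice, which is a matching of size n_0
    for s = 1 and the set of all edges for s = r. Letting one more coordinate s
    vary, a slice splits into n_s smaller ones through a Latin rectangle
    V 0 x V s.

    If there is no rainbow k-matching, a slice has at most
    (k-2) n_1 ... n_{s-1} + 1 colours, by induction on s. A smaller slice
    attaining its bound contains a rainbow (k-1)-matching R by averaging, and
    since n_0 >= 2k-1 each of the other smaller slices has an edge disjoint
    from R, whose colour therefore occurs in R; so the others contribute at most
    (k-2) n_1 ... n_{s-1} new colours each.

    In the equality case the smaller slices share one common colour a and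
    nothing else, and varying the Latin rectangle shows that every other colour
    occurs exactly once. The set G of edges not coloured a then has
    (k-2) n_1 ... n_{r-1} elements and no (k-1)-matching, so every matching of
    size n_0 meets G in exactly k-2 edges. Exchanging one coordinate of two
    disjoint edges preserves the number of them in G, which forces membership
    in G to depend on a single coordinate. *)

Set Implicit Arguments.
Unset Strict Implicit.
Unset Printing Implicit Defensive.

(** * Unions of sets of bounded size *)

Lemma card_bigcup_leq (I C : finType) (P : pred I) (F : I -> {set C}) :
  #|\bigcup_(t | P t) F t| <= \sum_(t | P t) #|F t|.
Proof.
elim/big_rec2: _ => [|t m A _ IH]; first by rewrite cards0.
by apply: leq_trans (leq_card_setU _ _) _; rewrite leq_add2l.
Qed.

(** Some [S t] has size [q.+1], since otherwise the union is too small. Every other set meets it,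
    hence adds at most [q] elements, and the union has at most [#|I| * q + 1]. As this bound is
    attained, nothing may be lost in the count, which forces all the sets to be maximal and to form
    a sunflower with core [a]. *)
Lemma union_card_max (I C : finType) (S : I -> {set C}) q :
    2 < #|I| -> (forall t, #|S t| <= q.+1) ->
    (forall t u, #|S t| = q.+1 -> S t :&: S u != set0) ->
    #|I| * q < #|\bigcup_t S t| ->
  #|\bigcup_t S t| = (#|I| * q).+1 /\
  exists a, forall t, [/\ #|S t| = q.+1, a \in S t &
    forall u, t != u -> S t :&: S u \subset [set a]].
Proof.
move=> I3 Sle Smeet big.
have [t0 t0max] : exists t0, #|S t0| = q.+1.
  have [/existsP[t /eqP tq]|] := boolP [exists t, #|S t| == q.+1]; first by exists t.
  rewrite negb_exists => /forallP noq.
  move: big; rewrite ltnNge => /negP[].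
  apply: leq_trans (card_bigcup_leq _ _) _.
  rewrite -sum_nat_const; apply: leq_sum => t _.
  by have := noq t; have := Sle t; lia.
pose D t u := S u :\: S t.
have Dle t u : #|S t| = q.+1 -> #|D t u| <= q.
  move=> tmax; have := Smeet t u tmax; rewrite -card_gt0 setIC.
  by have := cardsID (S t) (S u); have := Sle u; rewrite /D; lia.
(* Bound on the union in which [X] stands for the contribution of [S u] beyond [S t]: first [D t u],
   later that set minus a point. *)
have key t u X : #|S t| = q.+1 -> u != t ->
    \bigcup_t S t \subset S t :|: X :|: \bigcup_(v | (v != t) && (v != u)) D t v ->
    #|\bigcup_t S t| <= q.+1 + #|X| + (#|I| - 2) * q.
  move=> tmax ut sub; apply: leq_trans (subset_leq_card sub) _.
  apply: leq_trans (leq_card_setU _ _) _; apply: leq_add.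
    by apply: leq_trans (leq_card_setU _ _) _; rewrite tmax.
  apply: leq_trans (card_bigcup_leq _ _) _.
  have -> : #|I| - 2 = #|[pred v | (v != t) && (v != u)]|.
    rewrite -(cardC (pred2 t u)) card2 eq_sym ut addKn.
    by apply: eq_card => v; rewrite !inE negb_or.
  by rewrite -sum_nat_const; apply: leq_sum => v _; apply: Dle.
have cov t u : \bigcup_t S t \subset
    S t :|: D t u :|: \bigcup_(v | (v != t) && (v != u)) D t v.
  apply/subsetP=> x /bigcupP[v _ xv]; rewrite !inE.
  case xt: (x \in S t) => //=; case: (eqVneq v u) => [<-|vu]; first by rewrite xv.
  apply/orP; right; apply/bigcupP; exists v; last by rewrite !inE xt.
  by rewrite vu andbT; apply: contraFneq xt => <-.
have Iq : #|I| * q = 2 * q + (#|I| - 2) * q by rewrite -mulnDl; congr (_ * _); lia.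
have Deq t u : #|S t| = q.+1 -> u != t -> #|D t u| = q.
  by move=> tmax ut; have := key _ _ _ tmax ut (cov t u); have := Dle t u tmax; lia.
have [u0 u0t0] : exists u, u != t0.
  have [/existsP[u ut]|] := boolP [exists u, u != t0]; first by exists u.
  rewrite negb_exists => /forallP al.
  have : #|I| <= #|pred1 t0|.
    by apply: subset_leq_card; apply/subsetP=> u _; have := al u; rewrite negbK.
  by rewrite card1; lia.
have tot : #|\bigcup_t S t| = (#|I| * q).+1.
  by have := key _ _ _ t0max u0t0 (cov t0 u0); rewrite (Deq _ _ t0max u0t0); lia.
split=> //.
have allmax t : #|S t| = q.+1.
  case: (eqVneq t t0) => [->//|tt0].
  have := Deq _ _ t0max tt0; have := Smeet t0 t t0max; rewrite -card_gt0 setIC.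
  by have := cardsID (S t0) (S t); have := Sle t; rewrite /D; lia.
have meet1 t u : u != t -> exists a, S t :&: S u = [set a].
  move=> ut; apply/cards1P.
  have := Deq _ _ (allmax t) ut; have := cardsID (S t) (S u).
  by have := allmax u; rewrite /D setIC; lia.
(* If [x] were outside [S t], then [S v] would already cover it, so it could be dropped from [D t u]
   and the count would fall below its known value. *)
have triple t u v x : u != t -> v != t -> u != v -> x \in S u -> x \in S v ->
    x \in S t.
  move=> ut vt uv xu xv; apply/negPn/negP => xt.
  have xD : x \in D t u by rewrite inE xt xu.
  have sub : \bigcup_t S t \subset
      S t :|: D t u :\ x :|: \bigcup_(v | (v != t) && (v != u)) D t v.
    apply/subsetP=> y /(subsetP (cov t u)); case: (eqVneq y x) => [->|yx].
      move=> _; rewrite inE; apply/orP; right; apply/bigcupP; exists v.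
        by rewrite vt eq_sym uv.
      by rewrite inE xt xv.
    by rewrite !inE yx.
  have := key _ _ _ (allmax t) ut sub; have := Deq _ _ (allmax t) ut.
  by rewrite (cardsD1 x (D t u)) xD; lia.
have [a Ea] := meet1 t0 u0 u0t0; exists a.
have aS t : a \in S t.
  have : a \in S t0 :&: S u0 by rewrite Ea set11.
  case/setIP=> a0 au; case: (eqVneq t t0) => [->//|tt0].
  by case: (eqVneq t u0) => [->//|tu]; apply: (@triple t t0 u0); rewrite // eq_sym.
move=> t; split=> // u tu; rewrite eq_sym in tu.
have [b Eb] := meet1 t u tu; rewrite Eb.
have : a \in [set b] by rewrite -Eb inE !aS.
by rewrite inE => /eqP->.
Qed.

(** * Latin rectangles *)

Definition latin (T : finType) (A B : {set T}) (psi : 'I_#|B| -> T -> T) :=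
  [/\ forall t, {in A, forall x, psi t x \in B},
      forall t, {in A &, injective (psi t)},
      {in A & B, forall x y, exists t, psi t x = y} &
      {in A, forall x, injective (psi^~ x)}].

(** The cyclic shifts of [f], with respect to an enumeration of [B]: their graphs partition the
    product of [A] and [B], and the shift by 0 is [f] itself. *)
Lemma latin_through (T : finType) (A B : {set T}) (f : T -> T) :
    0 < #|B| -> {in A, forall x, f x \in B} -> {in A &, injective f} ->
  exists2 psi : 'I_#|B| -> T -> T, latin A psi &
    exists t, {in A, psi t =1 f}.
Proof.
move=> B0 fB finj; have [y0 _] := card_gt0P B0.
have en : size (enum B) = #|B| by rewrite cardE.
pose al x := index (f x) (enum B).
have alB x : x \in A -> al x < #|B| by move=> xA; rewrite -en index_mem mem_enum fB.
pose psi (t : 'I_#|B|) x := nth y0 (enum B) ((al x + t) %% #|B|).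
have inj i j : nth y0 (enum B) (i %% #|B|) = nth y0 (enum B) (j %% #|B|) ->
    i = j %[mod #|B|].
  by move/eqP; rewrite nth_uniq ?enum_uniq ?en ?ltn_pmod // => /eqP.
exists psi; last first.
  exists (Ordinal B0) => x xA; rewrite /psi /= addn0 modn_small ?alB // nth_index //.
  by rewrite mem_enum fB.
split.
- by move=> t x xA; rewrite -mem_enum mem_nth // en ltn_pmod.
- move=> t x x' xA x'A /inj/eqP; rewrite eqn_modDr !modn_small ?alB // => /eqP.
  move/(congr1 (nth y0 (enum B))); rewrite !nth_index ?mem_enum ?fB //.
  exact: finj.
- move=> x y xA yB.
  have yl : index y (enum B) < #|B| by rewrite -en index_mem mem_enum.
  (* The shift is the difference of the two indices; adding [#|B|] keeps the truncated subtraction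
     exact. *)
  exists (Ordinal (ltn_pmod (index y (enum B) + #|B| - al x) B0)).
  rewrite /psi /= modnDmr subnKC ?modnDr; last by have := alB x xA; lia.
  by rewrite modn_small // nth_index // mem_enum.
move=> x xA t t' /= /inj/eqP; rewrite eqn_modDl !modn_small ?ltn_ord // => /eqP.
exact: val_inj.
Qed.

Lemma latin_comp (T : finType) (A B : {set T}) (psi : 'I_#|B| -> T -> T)
    (h : T -> T) :
    {in A, forall x, h x \in A} -> {in A &, injective h} -> latin A psi ->
  latin A (fun t => psi t \o h).
Proof.
move=> hA hinj [pB pinj psurj pt]; split=> /=.
- by move=> t x xA; apply/pB/hA.
- by move=> t x y xA yA /pinj E; apply: hinj => //; apply: E; apply: hA.
- by move=> x y xA yB; apply: psurj => //; apply: hA.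
- by move=> x xA; apply: pt; apply: hA.
Qed.

(** * Representatives of colours and subsets of given size *)

Lemma rainbow_transversal (T C : finType) (c : T -> C) (A : {set T}) :
  exists R : {set T}, [/\ R \subset A, {in R &, injective c} & c @: R = c @: A].
Proof.
have [n] := ubnP #|A|; elim: n A => // n IH B Bn.
have [->|[x xB]] := set_0Vmem B.
  by exists set0; split; rewrite ?sub0set // => x y; rewrite inE.
pose A := B :\ x.
have [|R [RA Rinj RE]] := IH A; first by move: Bn; rewrite (cardsD1 x) xB.
rewrite -(setD1K xB) -/A.
case: (boolP (c x \in c @: A)) => cx.
  exists R; split=> //; first by apply: subset_trans RA (subsetUr _ _).
  by rewrite imsetU1 RE (setUidPr _) // sub1set.
exists (x |: R); split; first exact: setUS.
  rewrite -RE in cx.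
  have nR y : y \in R -> c x <> c y by move=> yR E; case/imsetP: cx; exists y.
  move=> y z /setU1P[->|yR] /setU1P[->|zR] // E; first by case: (nR z).
    by case: (nR y).
  exact: Rinj.
by rewrite !imsetU1 RE.
Qed.

Lemma subset_of_card (T : finType) (A : {set T}) m :
  m <= #|A| -> exists2 B : {set T}, B \subset A & #|B| = m.
Proof.
move=> mA; exists [set x in take m (enum A)].
  by apply/subsetP=> x; rewrite inE => /mem_take; rewrite mem_enum.
rewrite cardsE.
have /card_uniqP-> : uniq (take m (enum A)) by rewrite take_uniq ?enum_uniq.
by rewrite size_takel // -cardE.
Qed.

(** * Slices, their Latin splittings and averaging over them *)

Section Slices.

Variables (r : nat) (T : finType) (V : 'I_r.+1 -> {set T}).

Local Notation V0 := (V ord0).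
Local Notation edge := {ffun 'I_r.+1 -> T}.

Definition edges : {set edge} := [set f : edge | [forall i, f i \in V i]].

Definition disj (f g : edge) := [forall i, f i != g i].

Definition fmatching (M : {set edge}) :=
  {in M &, forall f g, f != g -> disj f g}.

Definition transv (phi : 'I_r.+1 -> T -> T) : Prop :=
  [/\ {in V0, phi ord0 =1 id},
      forall i, {in V0, forall x, phi i x \in V i} &
      forall i, {in V0 &, injective (phi i)}].

(* Interpolates between the matching spanned by phi (s = 1) and the set of all
   edges (s = r.+1): the coordinates from s on are tied to the first one. *)
Definition slice s (phi : 'I_r.+1 -> T -> T) : {set edge} :=
  [set f : edge in edges | [forall i : 'I_r.+1, (s <= i) ==> (f i == phi i (f ord0))]].

Definition row (phi : 'I_r.+1 -> T -> T) x : edge := [ffun i => phi i x].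

Definition upd (phi : 'I_r.+1 -> T -> T) j (f : T -> T) i :=
  if i == j then f else phi i.

(** The number of matchings [slice 1] into which repeated Latin splitting cuts [slice s]. *)
Definition slice_deg s := \prod_(i < r.+1 | 0 < i < s) #|V i|.

Lemma disjC (f g : edge) : disj f g = disj g f.
Proof. by apply: eq_forallb => i; rewrite eq_sym. Qed.

Lemma edgesP (f : edge) : reflect (forall i, f i \in V i) (f \in edges).
Proof. by rewrite inE; apply: forallP. Qed.

Lemma sliceP s phi (f : edge) :
  reflect ((forall i, f i \in V i) /\
           forall i : 'I_r.+1, s <= i -> f i = phi i (f ord0))
          (f \in slice s phi).
Proof.
rewrite inE; apply: (iffP andP) => -[fV fphi]; split.
- exact/edgesP.
- by move=> i si; apply/eqP/(implyP (forallP fphi i)).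
- exact/edgesP.
- by apply/forallP=> i; apply/implyP=> /fphi->.
Qed.

Lemma slice_edges s phi : slice s phi \subset edges.
Proof. by apply/subsetP=> f /sliceP[fV _]; apply/edgesP. Qed.

Lemma slice_full phi : slice r.+1 phi = edges.
Proof.
apply/setP=> f; apply/sliceP/edgesP => [[]//|fV]; split=> // i.
by rewrite leqNgt ltn_ord.
Qed.

Lemma sub_slice s s' phi : s <= s' -> slice s phi \subset slice s' phi.
Proof.
move=> ss'; apply/subsetP=> f /sliceP[fV fphi]; apply/sliceP; split=> // i s'i.
by apply: fphi; apply: leq_trans ss' s'i.
Qed.

Lemma eq_slice s phi phi' :
  (forall i : 'I_r.+1, s <= i -> {in V0, phi i =1 phi' i}) ->
  slice s phi = slice s phi'.
Proof.
move=> E; apply/setP=> f; apply/sliceP/sliceP=> -[fV fphi]; split=> // i si.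
  by rewrite -E // fphi.
by rewrite E // fphi.
Qed.

Lemma row_slice s phi x : transv phi -> x \in V0 -> row phi x \in slice s phi.
Proof.
move=> [phi0 phiV _] xV; apply/sliceP; split=> i; rewrite !ffunE ?phi0 //.
exact: phiV.
Qed.

Lemma slice1 phi : transv phi -> slice 1 phi = row phi @: V0.
Proof.
move=> Tphi; apply/setP=> f; apply/idP/imsetP=> [/sliceP[fV fphi]|[x xV ->]].
  exists (f ord0) => //; apply/ffunP=> i; rewrite ffunE.
  case: (posnP i) => [i0|]; last exact: fphi.
  have -> : i = ord0 by apply: val_inj.
  by have [->] := Tphi.
exact: row_slice.
Qed.

Lemma row_inj phi : transv phi -> {in V0 &, injective (row phi)}.
Proof.
move=> [phi0 _ _] x y xV yV /ffunP/(_ ord0).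
by rewrite !ffunE !phi0.
Qed.

Lemma card_slice1 phi : transv phi -> #|slice 1 phi| = #|V0|.
Proof. by move=> Tphi; rewrite slice1 // card_in_imset //; apply: row_inj. Qed.

Lemma slice1_matching phi : transv phi -> fmatching (slice 1 phi).
Proof.
move=> Tphi; rewrite slice1 // => f g /imsetP[x xV ->] /imsetP[y yV ->] xy.
apply/forallP=> i; rewrite !ffunE; apply: contraNneq xy.
by have [_ _ phiI] := Tphi; move/phiI=> -> //.
Qed.

Lemma fmatching_sub (M M' : {set edge}) :
  M' \subset M -> fmatching M -> fmatching M'.
Proof. by move=> /subsetP sM mM f g fM gM; apply: mM; apply: sM. Qed.

Lemma transv_upd phi (j : 'I_r.+1) (f : T -> T) : transv phi -> 0 < j ->
  {in V0, forall x, f x \in V j} -> {in V0 &, injective f} ->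
  transv (upd phi j f).
Proof.
move=> [phi0 phiV phiI] j0 fV fI; split.
- by rewrite /upd; case: eqP j0 => // <-.
- by move=> i; rewrite /upd; case: eqP => // ->.
- by move=> i; rewrite /upd; case: eqP => // ->.
Qed.

Lemma slice_upd phi (j : 'I_r.+1) psi : 0 < j -> latin V0 psi ->
  slice j.+1 phi = \bigcup_(t : 'I_#|V j|) slice j (upd phi j (psi t)).
Proof.
move=> j0 [pV _ ps _]; apply/setP=> f; apply/idP/bigcupP.
  move/sliceP=> [fV fphi]; have [t Et] := ps _ _ (fV ord0) (fV j).
  exists t => //; apply/sliceP; split=> // i ji; rewrite /upd.
  case: (eqVneq i j) => [->//|ij]; apply: fphi.
  by rewrite ltn_neqAle ji andbT eq_sym.
case=> t _ /sliceP[fV fphi]; apply/sliceP; split=> // i ji.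
by rewrite fphi ?(ltnW ji) // /upd; case: eqP ji => // ->; rewrite ltnn.
Qed.

Lemma slice_upd_inj phi (j : 'I_r.+1) psi (t u : 'I_#|V j|) f :
  latin V0 psi -> f \in slice j (upd phi j (psi t)) ->
  f \in slice j (upd phi j (psi u)) -> t = u.
Proof.
move=> [_ _ _ pI] /sliceP[fV ft] /sliceP[_ fu]; apply: pI (fV ord0) _ _ _ => /=.
by have := ft j (leqnn _); rewrite fu // /upd eqxx => ->.
Qed.

Lemma slice_deg1 : slice_deg 1 = 1.
Proof. by rewrite /slice_deg big_pred0 // => i; lia. Qed.

Lemma slice_degS (j : 'I_r.+1) : 0 < j -> slice_deg j.+1 = #|V j| * slice_deg j.
Proof.
move=> j0; rewrite /slice_deg (bigD1 j) /=; last by rewrite j0 /=.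
by congr (_ * _); apply: eq_bigl => i; rewrite -val_eqE /=; lia.
Qed.

Hypothesis V0min : forall i, #|V0| <= #|V i|.
Hypothesis V0gt0 : 0 < #|V0|.

Lemma card_part_gt0 i : 0 < #|V i|.
Proof. exact: leq_trans (V0min i). Qed.

Lemma transv_exists : exists phi, transv phi.
Proof.
pose phi i x := nth x (enum (V i)) (index x (enum V0)); exists phi.
have il i x : x \in V0 -> index x (enum V0) < size (enum (V i)).
  by move=> xV; rewrite -cardE (leq_trans _ (V0min i)) // cardE index_mem mem_enum.
split=> [x xV|i x xV|i x y xV yV].
- by rewrite /phi nth_index ?mem_enum.
- by rewrite -mem_enum mem_nth // il.
rewrite /phi (set_nth_default y) ?il // => /eqP.
rewrite nth_uniq ?il ?enum_uniq // => /eqP /(congr1 (nth x (enum V0))).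
by rewrite !nth_index ?mem_enum.
Qed.

Lemma latin_upd_exists phi j : transv phi ->
  exists2 psi : 'I_#|V j| -> T -> T, latin V0 psi &
    exists t, {in V0, psi t =1 phi j}.
Proof.
by move=> [_ pV pI]; apply: latin_through => //; apply: card_part_gt0.
Qed.

Lemma transv_latin phi (j : 'I_r.+1) psi (t : 'I_#|V j|) :
  transv phi -> 0 < j -> latin V0 psi -> transv (upd phi j (psi t)).
Proof. by move=> Tphi j0 [pV pI _ _]; apply: transv_upd. Qed.

Lemma card_slice_upd (G : {set edge}) phi (j : 'I_r.+1) psi : 0 < j -> latin V0 psi ->
  #|G :&: slice j.+1 phi| =
  \sum_(t : 'I_#|V j|) #|G :&: slice j (upd phi j (psi t))|.
Proof.
move=> j0 Lpsi; rewrite (slice_upd _ j0 Lpsi).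
rewrite -sum1_card (eq_bigr _ (fun t _ => esym (sum1_card _))).
rewrite (exchange_big_dep [in G :&: \bigcup_t slice j (upd phi j (psi t))]) /=.
  apply: eq_bigr => f /setIP[fG /bigcupP[t _ ft]].
  rewrite sum1_card (@eq_card1 _ t) // => u; rewrite [LHS]inE fG [RHS]inE /=.
  apply/idP/eqP => [fu|->] //.
  exact/esym/(slice_upd_inj Lpsi ft).
by move=> t f _ /setIP[fG ft]; rewrite inE fG; apply/bigcupP; exists t.
Qed.

(** Averaging, one splitting at a time: some piece has at least the average share of [G], down to a
    matching. *)
Lemma slice_pigeonhole (G : {set edge}) m s phi :
    0 < s <= r.+1 -> transv phi -> m * slice_deg s < #|G :&: slice s phi| ->
  exists phi', [/\ transv phi', slice 1 phi' \subset slice s phi &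
    m < #|G :&: slice 1 phi'|].
Proof.
elim: s phi => // -[_|s IH] phi /andP[_ sr] Tphi.
  by rewrite slice_deg1 muln1 => Gm; exists phi.
pose j : 'I_r.+1 := Ordinal sr.
have [psi Lpsi _] := latin_upd_exists j Tphi.
rewrite (slice_degS (j := j)) // (card_slice_upd _ _ (j := j) _ Lpsi) // => Gm.
have [/existsP[t Gt]|] :=
  boolP [exists t, m * slice_deg j < #|G :&: slice j (upd phi j (psi t))|].
  have Tt : transv (upd phi j (psi t)) by apply: transv_latin.
  have [|phi' [Tphi' sub Gphi']] := IH _ _ Tt Gt; first by rewrite /= ltnW.
  exists phi'; split=> //; apply: subset_trans sub _.
  by rewrite (slice_upd phi (j := j) _ Lpsi) //; apply: bigcup_sup.
rewrite negb_exists => /forallP Gt; move: Gm; rewrite ltnNge => /negP[].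
rewrite mulnCA -[X in X * _]card_ord -sum_nat_const; apply: leq_sum => t _.
by rewrite leqNgt.
Qed.

Lemma slice_leq (G : {set edge}) m s phi :
    (forall phi', transv phi' -> #|G :&: slice 1 phi'| <= m) ->
    0 < s <= r.+1 -> transv phi ->
  #|G :&: slice s phi| <= m * slice_deg s.
Proof.
move=> Gm sr Tphi; rewrite leqNgt; apply/negP => /(slice_pigeonhole sr Tphi).
by case=> phi' [Tphi' _]; rewrite ltnNge Gm.
Qed.

(** When the total bound is attained, every piece of every splitting attains its own. Since a Latin
    rectangle exists through any prescribed injection, each [phi'] that agrees with [phi] from [s]
    on is reached as a piece. *)
Lemma slice_eq (G : {set edge}) m s phi phi' :
    (forall phi', transv phi' -> #|G :&: slice 1 phi'| <= m) ->
    0 < s <= r.+1 -> transv phi -> #|G :&: slice s phi| = m * slice_deg s ->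
    transv phi' ->
    (forall i : 'I_r.+1, s <= i -> {in V0, phi' i =1 phi i}) ->
  #|G :&: slice 1 phi'| = m.
Proof.
move=> Gm; elim: s phi => // -[_|s IH] phi /andP[_ sr] Tphi.
  by rewrite slice_deg1 muln1 => <- Tphi' /eq_slice->.
pose j : 'I_r.+1 := Ordinal sr => E Tphi' pp'.
(* The rectangle is taken through [phi' j], so the piece [t0] agrees with [phi'] from coordinate [j]
   on. *)
have [psi Lpsi [t0 Et0]] := latin_upd_exists j Tphi'.
have Tt t : transv (upd phi j (psi t)) by apply: transv_latin.
have sr' : 0 < j <= r.+1 by rewrite /= ltnW.
have le t : #|G :&: slice j (upd phi j (psi t))| <= m * slice_deg j.
  exact: slice_leq.
apply: (IH (upd phi j (psi t0))) => //.
  move: E; rewrite (slice_degS (j := j)) // (card_slice_upd _ _ (j := j) _ Lpsi) //.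
  rewrite mulnCA -[X in X * _]card_ord -sum_nat_const => /eqP.
  have /leqif_sum/= := fun t (_ : true) => leqif_eq (le t).
  by move=> /leqifP; case: ifP => [/forallP/(_ t0)/eqP//|_ /ltn_eqF->].
move=> i ji x xV; rewrite /upd; case: (eqVneq i j) => [->|ij]; first by rewrite Et0.
by apply: pp' => //; rewrite ltn_neqAle ji andbT eq_sym.
Qed.

(** The tied coordinates of [g] are determined by [x] and avoid [R] by hypothesis. Each free one can
    avoid [R] because [R] has fewer edges than any part has vertices. *)
Lemma slice_avoid s phi (R : {set edge}) x :
    transv phi -> x \in V0 -> #|R| < #|V0| ->
    {in R, forall f : edge, f ord0 != x} ->
    {in R, forall (f : edge) (i : 'I_r.+1), s <= i -> f i != phi i x} ->
  exists2 g, g \in slice s phi & {in R, forall f, disj f g}.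
Proof.
move=> [phi0 pV pI] xV Rl R0 Rs.
pose free i := V i :\: [set (f : edge) i | f in R].
have [y yP] : exists y : 'I_r.+1 -> T, forall i, y i \in free i.
  (* The default [x] is never taken: [free i] is not empty, since [R] uses at most [#|R|] points of
     [V i]. *)
  exists (fun i => odflt x [pick z in free i]) => i.
  case: pickP => //= no.
  have : #|V i| <= #|[set (f : edge) i | f in R]|.
    apply: subset_leq_card; apply/subsetP=> z zV.
    by have := no z; rewrite inE zV andbT => /negbFE.
  by move=> /leq_trans/(_ (leq_imset_card _ _))/(leq_trans (V0min i)); rewrite leqNgt Rl.
pose g : edge := [ffun i => if i == ord0 then x else if s <= i then phi i x else y i].
exists g.
  apply/sliceP; split=> i; rewrite !ffunE.
    by case: eqP => [->//|_]; case: ifP => _; [apply: pV|have /setDP[] := yP i].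
  by move=> si; rewrite si eqxx; case: eqP => // ->; rewrite phi0.
move=> f fR; apply/forallP=> i; rewrite ffunE.
case: (eqVneq i ord0) => [->|_]; first exact: R0.
case: ifP => [|_]; first exact: Rs.
have /setDP[_] := yP i; apply: contraNneq => <-.
exact: (imset_f (fun f : edge => f i)).
Qed.

End Slices.

(** * Colours in slices: the upper bound and the uniqueness of colours *)

Section Colors.

Variables (r : nat) (T : finType) (V : 'I_r.+1 -> {set T}).

Local Notation V0 := (V ord0).
Local Notation edge := {ffun 'I_r.+1 -> T}.

Variable k : nat.
Hypothesis k_gt2 : 2 < k.

Variables (C : finType) (c : edge -> C).
Hypothesis no_rainbow : forall M : {set edge}, M \subset edges V ->
  fmatching M -> {in M &, injective c} -> #|M| < k.

(** With a new colour, [g] would extend [R] to a rainbow [k]-matching. *)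
Lemma color_of_avoiding (R : {set edge}) g :
    R \subset edges V -> fmatching R -> {in R &, injective c} -> #|R| = k.-1 ->
    g \in edges V -> {in R, forall f, disj f g} ->
  c g \in c @: R.
Proof.
move=> RE Rm Ri Rk gE gR; apply/negPn/negP => cg.
have gnR : g \notin R.
  by apply: contraNN cg => gR'; apply: imset_f.
have ncg f : f \in R -> c g <> c f by move=> fR E; case/imsetP: cg; exists f.
have := no_rainbow (M := g |: R).
have -> : #|g |: R| = k by rewrite cardsU1 gnR Rk; lia.
rewrite ltnn => H; apply: notF; apply: H.
- by rewrite subUset sub1set gE.
- move=> e f /setU1P[->|eR] /setU1P[->|fR] //; rewrite ?eqxx //.
  + by move=> _; rewrite disjC gR.
  + by move=> _; rewrite gR.
  + exact: Rm.
- move=> e f /setU1P[->|eR] /setU1P[->|fR] // E; first by case: (ncg f).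
    by case: (ncg e).
  exact: Ri.
Qed.

Hypothesis V0min : forall i, #|V0| <= #|V i|.
Hypothesis V0k : 2 * k - 1 <= #|V0|.

Let V0gt0 : 0 < #|V0|. Proof. by lia. Qed.

(** Averaging applied to a set with one edge of each colour: some matching contains more than [m] of
    its edges. *)
Lemma rainbow_in_slice m s phi :
    0 < s <= r.+1 -> transv V phi ->
    m * slice_deg V s < #|c @: slice V s phi| ->
  exists R : {set edge}, [/\ R \subset slice V s phi, fmatching R,
    {in R &, injective c} & #|R| = m.+1].
Proof.
move=> sr Tphi; have [G [Gs Ginj <-]] := rainbow_transversal c (slice V s phi).
rewrite card_in_imset // -(setIidPl Gs) => /(slice_pigeonhole V0min V0gt0 sr Tphi).
case=> phi' [Tphi' _ /subset_of_card[R RG cR]].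
exists R; split=> //.
- by apply: subset_trans Gs; apply: subset_trans RG (subsetIl _ _).
- apply: fmatching_sub (slice1_matching Tphi').
  by apply: subset_trans RG (subsetIr _ _).
- move=> f g /(subsetP RG)/setIP[fG _] /(subsetP RG)/setIP[gG _].
  exact: Ginj.
Qed.

(** The full block [t] contains a rainbow [k.-1]-matching [R]. An edge of block [u] that is disjoint
    from [R] must repeat a colour of [R], which is a colour of block [t]. *)
Lemma slices_meet phi (j : 'I_r.+1) psi (t u : 'I_#|V j|) :
    0 < j -> transv V phi -> latin V0 psi ->
    #|c @: slice V j (upd phi j (psi t))| = ((k - 2) * slice_deg V j).+1 ->
  c @: slice V j (upd phi j (psi t)) :&: c @: slice V j (upd phi j (psi u))
    != set0.
Proof.
move=> j0 Tphi Lpsi cmax.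
have Tt v := transv_latin v Tphi j0 Lpsi.
have jr : 0 < j <= r.+1 by rewrite j0 /= ltnW.
have [|R [RH Rm Ri Rk]] := @rainbow_in_slice (k - 2) j _ jr (Tt t).
  by rewrite cmax.
pose P0 := [set (f : edge) ord0 | f in R]; pose Pj := [set (f : edge) j | f in R].
pose X := [set x in V0 | psi u x \in Pj].
have [_ pI _ _] := Lpsi.
have Xle : #|X| <= #|R|.
  apply: leq_trans (leq_imset_card (fun f : edge => f j) _).
  rewrite -(@card_in_imset _ _ (psi u) X).
    apply: subset_leq_card; apply/subsetP=> y /imsetP[x xX ->].
    by move: xX; rewrite inE => /andP[].
  by move=> x y; rewrite !inE => /andP[xV _] /andP[yV _]; apply: pI.
have P0le : #|P0| <= #|R| := leq_imset_card _ _.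
(* The first coordinate [x] must avoid [P0], and its partner [psi u x] must avoid [Pj]. Each
   condition excludes at most [k - 1] points, and [2 * k - 2 < #|V0|]. *)
have [x] : exists x, x \in V0 :\: (P0 :|: X).
  apply/set0Pn; rewrite -card_gt0 cardsD subn_gt0.
  apply: leq_ltn_trans (subset_leq_card (subsetIr _ _)) _.
  apply: leq_ltn_trans (leq_card_setU _ _) _; lia.
rewrite !inE negb_or => /andP[/andP[xP0]] /[swap] xV; rewrite xV /= => xPj.
have [||f fR i ji|g gH gR] := @slice_avoid _ _ _ V0min j _ R x (Tt u) xV.
- by lia.
- move=> f fR; apply: contraNneq xP0 => <-.
  exact: (imset_f (fun f : edge => f ord0)).
- rewrite /upd; case: (eqVneq i j) => [->|ij].
    apply: contraNneq xPj => <-.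
    exact: (imset_f (fun f : edge => f j)).
  (* Beyond [j] both blocks are tied by the same injections [phi i], so different first coordinates
     suffice. *)
  have /sliceP[fV ->//] := subsetP RH f fR; rewrite /upd (negPf ij).
  have [_ _ phI] := Tphi.
  apply: contraNneq xP0 => /phI <-//.
  exact: (imset_f (fun f : edge => f ord0)).
have RE : R \subset edges V := subset_trans RH (slice_edges _ _ _).
have cg : c g \in c @: R.
  apply: color_of_avoiding => //; first by rewrite Rk; lia.
  exact: (subsetP (slice_edges _ _ _)) gH.
apply/set0Pn; exists (c g); rewrite inE (imset_f c gH) andbT.
exact: subsetP (imsetS c RH) _ cg.
Qed.

Lemma colors_slice_upd phi (j : 'I_r.+1) psi : 0 < j -> latin V0 psi ->
  c @: slice V j.+1 phi =
  \bigcup_(t : 'I_#|V j|) c @: slice V j (upd phi j (psi t)).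
Proof.
move=> j0 Lpsi; rewrite (slice_upd _ j0 Lpsi).
by apply: (big_morph (fun A : {set edge} => c @: A)) => [A B|];
  [apply: imsetU|apply: imset0].
Qed.

Lemma colors_slice_leq s phi : 0 < s <= r.+1 -> transv V phi ->
  #|c @: slice V s phi| <= ((k - 2) * slice_deg V s).+1.
Proof.
elim: s phi => // -[_|s IH] phi /andP[_ sr] Tphi.
  rewrite slice_deg1 muln1.
  have [R [RH Ri <-]] := rainbow_transversal c (slice V 1 phi).
  rewrite card_in_imset //.
  have : #|R| < k.
    apply: no_rainbow => //; first exact: subset_trans RH (slice_edges _ _ _).
    exact: fmatching_sub RH (slice1_matching Tphi).
  by lia.
pose j : 'I_r.+1 := Ordinal sr.
have [psi Lpsi _] := latin_upd_exists V0min V0gt0 j Tphi.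
rewrite leqNgt; apply/negP => big.
have := big; rewrite (colors_slice_upd phi (j := j) _ Lpsi) //.
rewrite (slice_degS V (j := j)) // mulnCA -[X in X * _]card_ord => big'.
(* Already the bound weakened by one forces the exact size [#|V j| * q + 1] of the union, which
   contradicts [big']. *)
have [] := union_card_max _ _ _ (ltnW big').
- by rewrite card_ord; have := V0min j; lia.
- move=> t; apply: IH; first by rewrite /= ltnW.
  exact: transv_latin.
- by move=> t u; apply: slices_meet.
- by move=> E; rewrite E ltnn in big'.
Qed.

Lemma colors_slice_eq phi (j : 'I_r.+1) psi :
    0 < j -> transv V phi -> latin V0 psi ->
    #|c @: slice V j.+1 phi| = ((k - 2) * slice_deg V j.+1).+1 ->
  exists a, forall t : 'I_#|V j|,
    [/\ #|c @: slice V j (upd phi j (psi t))| = ((k - 2) * slice_deg V j).+1,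
        a \in c @: slice V j (upd phi j (psi t)) &
        forall u, t != u -> c @: slice V j (upd phi j (psi t)) :&:
          c @: slice V j (upd phi j (psi u)) \subset [set a]].
Proof.
move=> j0 Tphi Lpsi; rewrite (colors_slice_upd phi j0 Lpsi).
rewrite (slice_degS V (j := j)) // mulnCA -[X in X * _]card_ord => E.
have [] := union_card_max _ _ _ (eq_leq (esym E)) => //.
- by rewrite card_ord; have := V0min j; lia.
- move=> t; apply: colors_slice_leq; last exact: transv_latin.
  by rewrite j0 /= ltnW.
- by move=> t u; apply: slices_meet.
Qed.

(* A colour other than the common colour a lives in one block H_t. If it had
   edges with distinct first coordinates, precomposing psi with a transposition
   would separate them, so it would be the common colour of the new
   decomposition; but H_t meets at most three of the new blocks. *)
Lemma same_color_same_block phi (j : 'I_r.+1) psi a f g :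
    0 < j -> transv V phi -> latin V0 psi ->
    #|c @: slice V j.+1 phi| = ((k - 2) * slice_deg V j.+1).+1 ->
    (forall t u : 'I_#|V j|, t != u -> c @: slice V j (upd phi j (psi t)) :&:
       c @: slice V j (upd phi j (psi u)) \subset [set a]) ->
    f \in slice V j.+1 phi -> g \in slice V j.+1 phi -> c f = c g -> c f != a ->
  f ord0 = g ord0 /\ exists t, f \in slice V j (upd phi j (psi t)) /\
    g \in slice V j (upd phi j (psi t)).
Proof.
move=> j0 Tphi Lpsi cmax meet fS gS cfg cfa.
have [pV pI _ pt] := Lpsi.
have : f \in slice V j.+1 phi := fS.
rewrite {1}(slice_upd phi j0 Lpsi) => /bigcupP[t _ ft].
have block e : e \in slice V j.+1 phi -> c e = c f ->
    e \in slice V j (upd phi j (psi t)).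
  rewrite (slice_upd phi j0 Lpsi) => /bigcupP[u _ eu] ce.
  case: (eqVneq t u) => [->//|tu]; case/negP: cfa.
  have : c f \in [set a]; last by rewrite inE.
  apply: (subsetP (meet t u tu)); rewrite inE (imset_f c ft).
  by rewrite -ce imset_f.
have gt := block g gS (esym cfg).
split; last by exists t.
apply/eqP/negPn/negP => f0g0.
have atj e : e \in slice V j (upd phi j (psi t)) -> e j = psi t (e ord0).
  by case/sliceP=> _ /(_ j (leqnn _)); rewrite /upd eqxx.
have [fV _] := sliceP _ _ _ _ ft; have [gV gs] := sliceP _ _ _ _ gt.
(* A third point: the transposition [h] of [f ord0] and [x] fixes [g ord0], so [g] stays in block
   [t] while [f] leaves it. *)
have [x xP] : exists x, x \in V0 :\: [set f ord0; g ord0].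
  apply/set0Pn; rewrite -card_gt0 cardsD subn_gt0.
  apply: leq_ltn_trans (subset_leq_card (subsetIr _ _)) _.
  by rewrite cards2; lia.
move: xP; rewrite !inE negb_or => /andP[/andP[xf xg] xV].
pose h := tperm (f ord0) x.
have hV : {in V0, forall y, h y \in V0}.
  by move=> y yV; rewrite /h; case: tpermP => // _; apply: fV.
have Lpsi' : latin V0 (fun u => psi u \o h).
  by apply: latin_comp => // y z _ _; apply: perm_inj.
have [a' a'P] := colors_slice_eq j0 Tphi Lpsi' cmax.
have atj' e u : e \in slice V j (upd phi j (psi u \o h)) -> e j = psi u (h (e ord0)).
  by case/sliceP=> _ /(_ j (leqnn _)); rewrite /upd eqxx.
have gt' : g \in slice V j (upd phi j (psi t \o h)).
  apply/sliceP; split=> // i ji; rewrite gs // /upd.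
  by case: ifP => // _; rewrite /= /h tpermD // eq_sym.
have : f \in slice V j.+1 phi := fS.
rewrite {1}(slice_upd phi j0 Lpsi') => /bigcupP[v _ fv].
have vt : v != t.
  apply/eqP=> vt; have := atj' _ _ fv; rewrite vt (atj _ ft) /h tpermL.
  by move/pI => E; rewrite E ?eqxx // in xf.
have Ea : c f = a'.
  have [_ _ /(_ _ vt)/subsetP/(_ (c f))] := a'P v.
  by rewrite !inE (imset_f c fv) cfg (imset_f c gt') => /(_ isT)/eqP.
have [_ _ ps _] := Lpsi.
(* An edge of the old block [t] lies in the new block [w1] if it starts at [f ord0], in [w2] if it
   starts at [x], and in [t] otherwise. As [#|V j| > 3], some new block [w] avoids all three, yet it
   must contain the colour of [f]. *)
have [w1 Ew1] := ps _ _ xV (pV t _ (fV ord0)).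
have [w2 Ew2] := ps _ _ (fV ord0) (pV t _ xV).
have [w] : exists w, w \in ~: [set t; w1; w2].
  apply/set0Pn; rewrite -card_gt0 cardsCs setCK card_ord subn_gt0.
  have : #|[set t; w1; w2]| <= 3.
    by apply: leq_trans (leq_card_setU _ _) _; rewrite cards1 cards2; case: (_ != _).
  by move/leq_ltn_trans; apply; move: (V0min j); clear -V0k k_gt2; lia.
rewrite !inE !negb_or => /andP[/andP[wt ww1] ww2].
have [_ /imsetP[e ew ce] _] := a'P w.
have eS : e \in slice V j.+1 phi.
  by rewrite (slice_upd phi j0 Lpsi'); apply/bigcupP; exists w.
have et := block e eS (esym (etrans Ea ce)).
have [eV _] := sliceP _ _ _ _ et.
have := atj' _ _ ew; rewrite (atj _ et) /h; case: tpermP => [E|E|_ _] Ee.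
- by case/eqP: ww1; apply: pt xV _ _ _; rewrite -Ee E Ew1.
- by case/eqP: ww2; apply: pt (fV ord0) _ _ _; rewrite -Ee E Ew2.
- by case/eqP: wt; apply: pt (eV ord0) _ _ _.
Qed.

(** Two edges of the same colour other than [a] lie in one block and have the same first coordinate.
    For [s = 2] the block is a matching, so they coincide; for larger [s], by induction, the block
    has at most one repeated colour [b], which remains to be excluded. *)
Lemma colors_slice_unique s phi :
    1 < s <= r.+1 -> transv V phi ->
    #|c @: slice V s phi| = ((k - 2) * slice_deg V s).+1 ->
  exists a, {in slice V s phi &, forall f g, c f = c g -> c f != a -> f = g}.
Proof.
elim: s phi => // s IH phi /andP[s1 sr] Tphi.
pose j : 'I_r.+1 := Ordinal sr => cmax.
have [psi Lpsi _] := latin_upd_exists V0min V0gt0 j Tphi.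
have j0 : 0 < j by [].
have [a aP] := colors_slice_eq j0 Tphi Lpsi cmax; exists a => f g fS gS cfg cfa.
have meet (t u : 'I_#|V j|) : t != u -> c @: slice V j (upd phi j (psi t)) :&:
       c @: slice V j (upd phi j (psi u)) \subset [set a].
  by have [_ _] := aP t; apply.
have [fg0 [t [ft gt]]] :=
  same_color_same_block j0 Tphi Lpsi cmax meet fS gS cfg cfa.
have Tt := transv_latin t Tphi j0 Lpsi.
have [tmax _ _] := aP t.
move: s1; rewrite ltnS leq_eqVlt => /orP[/eqP s1|s1].
  have j1 : j = 1 :> nat by rewrite /= -s1.
  move: ft gt; rewrite j1 slice1 // => /imsetP[x xV Ef] /imsetP[y yV Eg].
  have [p0 _ _] := Tt; move: fg0.
  by rewrite Ef Eg !ffunE !p0 // => ->.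
have [|b bP] := IH _ _ Tt tmax; first by rewrite s1 ltnW.
apply/eqP/negPn/negP => /eqP fg.
have cfb : c f = b.
  by apply/eqP/negPn/negP => cfb; apply: fg; apply: bP.
(* All edges of colour [b] start at [f ord0]. Removing the row there from the matching leaves
   [#|V0| - 1 >= k] edges that avoid [b], hence a rainbow matching that is too large. *)
pose e0 := row (upd phi j (psi t)) (f ord0).
pose M := slice V 1 (upd phi j (psi t)) :\ e0.
have MH : M \subset slice V j (upd phi j (psi t)).
  by apply: subset_trans (subsetDl _ _) (sub_slice _ _ _); apply: j0.
have [fV _] := sliceP _ _ _ _ ft.
have : #|M| < k.
  apply: no_rainbow.
  - exact: subset_trans MH (slice_edges _ _ _).
  - exact: fmatching_sub (subsetDl _ _) (slice1_matching Tt).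
  move=> e e' eM e'M cee'; apply: bP => //; try exact: (subsetP MH).
  apply/negP => /eqP ceb.
  have [] := same_color_same_block j0 Tphi Lpsi cmax meet _ fS _ _ (f := e).
  - rewrite (slice_upd phi j0 Lpsi); apply/bigcupP; exists t => //.
    exact: (subsetP MH).
  - by rewrite ceb cfb.
  - by rewrite ceb -cfb.
  move=> e0f _; have /setD1P[/eqP ne] := eM; rewrite slice1 // => /imsetP[x xV Ee].
  by have [p0 _ _] := Tt; apply: ne; rewrite /e0 -e0f Ee ffunE p0.
have := cardsD1 e0 (slice V 1 (upd phi j (psi t))).
have -> : e0 \in slice V 1 (upd phi j (psi t)) by apply: row_slice (fV ord0).
by rewrite -/M card_slice1 // add1n; move: #|M| V0k => m; clear -k_gt2; lia.
Qed.

End Colors.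

(** * Edge sets that meet every matching of size [#|V0|] equally often *)

Section Extremal.

Variables (r : nat) (T : finType) (V : 'I_r.+1 -> {set T}).

Local Notation V0 := (V ord0).
Local Notation edge := {ffun 'I_r.+1 -> T}.

Hypothesis V0min : forall i, #|V0| <= #|V i|.
Hypothesis V0gt2 : 2 < #|V0|.

Variables (m : nat) (G : {set edge}).
Hypothesis m_bounds : 0 < m < #|V0|.
Hypothesis G_edges : G \subset edges V.
Hypothesis G_regular : forall phi, transv V phi -> #|G :&: slice V 1 phi| = m.

Definition setc (f : edge) i y : edge := [ffun j => if j == i then y else f j].

Lemma setc_id (f : edge) i : setc f i (f i) = f.
Proof. by apply/ffunP=> j; rewrite ffunE; case: eqP => // ->. Qed.

Lemma setc_setc (f : edge) i y z : setc (setc f i y) i z = setc f i z.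
Proof. by apply/ffunP=> j; rewrite !ffunE; case: eqP. Qed.

Lemma setc_at (f : edge) i y : setc f i y i = y.
Proof. by rewrite ffunE eqxx. Qed.

Lemma setc_edges (f : edge) i y :
  f \in edges V -> y \in V i -> setc f i y \in edges V.
Proof.
move=> /edgesP fV yV; apply/edgesP=> j; rewrite ffunE.
by case: eqP => [->|].
Qed.

Lemma card_slice1_sum phi : transv V phi ->
  #|G :&: slice V 1 phi| = \sum_(x in V0) (row phi x \in G).
Proof.
move=> Tphi; rewrite slice1 //.
have -> : G :&: row phi @: V0 = row phi @: [set x in V0 | row phi x \in G].
  apply/setP=> f; rewrite inE; apply/andP/imsetP=> [[fG /imsetP[x xV Ef]]|[x]].
    by exists x => //; rewrite inE xV -Ef.
  by rewrite inE => /andP[xV xG] ->; split=> //; apply: imset_f.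
rewrite card_in_imset; last first.
  by move=> x y; rewrite !inE => /andP[xV _] /andP[yV _]; apply: (row_inj Tphi).
rewrite -sum1dep_card [RHS]big_mkcond [LHS]big_mkcond.
by apply: eq_bigr => x _; case: (x \in V0) => //=; case: (_ \in G).
Qed.

Lemma transv_through (e f : edge) :
    e \in edges V -> f \in edges V -> disj e f ->
  exists phi, [/\ transv V phi, row phi (e ord0) = e & row phi (f ord0) = f].
Proof.
move=> /edgesP eV /edgesP fV /forallP ef.
have [phi [p0 pV pI]] := transv_exists V0min.
(* Any [phi] is corrected by two transpositions per part: [p i] brings in [e], and then [q i] brings
   in [f] without moving [e i], because [e] and [f] are disjoint. *)
pose p i := tperm (phi i (e ord0)) (e i).
pose q i := tperm (p i (phi i (f ord0))) (f i).
have tV (A : {set T}) x y z : x \in A -> y \in A -> z \in A ->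
    tperm x y z \in A by case: tpermP.
have pe i : p i (phi i (e ord0)) = e i by rewrite /p tpermL.
have pW i x : x \in V0 -> p i (phi i x) \in V i.
  by move=> xV; apply: tV => //; apply: pV.
exists (fun i x => q i (p i (phi i x))); split.
- split=> [x xV|i x xV|i x y xV yV].
  + by rewrite /q /p !(p0 _ (eV ord0)) !(p0 _ (fV ord0)) !p0 ?tperm1 ?perm1 ?tperm1 ?perm1.
  + by apply: tV => //; apply: pW.
  + by move=> /perm_inj/perm_inj; apply: pI.
- apply/ffunP=> i; rewrite ffunE pe /q tpermD //; last by rewrite eq_sym ef.
  rewrite -pe; apply: contraNneq (ef ord0) => /perm_inj E.
  by apply/eqP/esym; apply: pI E; [apply: fV|apply: eV].
- by apply/ffunP=> i; rewrite ffunE /q tpermL.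
Qed.

(** A matching through [e] and [f] stays a matching after the exchange, with all its other edges
    unchanged, and both meet [G] in [m] edges. *)
Lemma swap_coordinate (e f : edge) i :
    e \in edges V -> f \in edges V -> disj e f ->
  (e \in G) + (f \in G) = (setc e i (f i) \in G) + (setc f i (e i) \in G).
Proof.
move=> eE fE ef; have [phi [Tphi re rf]] := transv_through eE fE ef.
have [p0 pV pI] := Tphi.
have eV := edgesP _ _ eE; have fV := edgesP _ _ fE.
have ne : f ord0 != e ord0 by rewrite eq_sym; apply: (forallP ef).
pose h := tperm (e ord0) (f ord0).
have hV x : x \in V0 -> h x \in V0 by rewrite /h; case: tpermP.
(* For [i != ord0] only coordinate [i] is exchanged. Coordinate 0 of [phi'] must remain the
   identity, so for [i = ord0] all the other coordinates are exchanged instead. *)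
pose phi' j x := if (j == i) == (i == ord0) then phi j x else phi j (h x).
have Tphi' : transv V phi'.
  split=> [x xV|j x xV|j x y xV yV]; rewrite /phi'.
  - by rewrite [ord0 == i]eq_sym eqxx p0.
  - by case: ifP => _; apply: pV => //; apply: hV.
  - case: ifP => _; first exact: pI.
    by move=> E; apply: (@perm_inj _ h); apply: pI E; apply: hV.
have split2 (F : T -> nat) : \sum_(x in V0) F x =
    F (e ord0) + (F (f ord0) +
      \sum_(x in V0 | (x != e ord0) && (x != f ord0)) F x).
  rewrite (bigD1 (e ord0)) //= (bigD1 (f ord0)) /= ?fV ?ne //.
  by congr (_ + (_ + _)); apply: eq_bigl => x; rewrite andbA.
have := etrans (G_regular Tphi) (esym (G_regular Tphi')).
rewrite !card_slice1_sum // !split2 re rf.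
have -> : \sum_(x in V0 | (x != e ord0) && (x != f ord0)) (row phi' x \in G) =
  \sum_(x in V0 | (x != e ord0) && (x != f ord0)) (row phi x \in G).
  apply: eq_bigr => x /and3P[xV xe xf]; congr (nat_of_bool (_ \in G)).
  apply/ffunP=> j; rewrite !ffunE /phi' /h tpermD 1?eq_sym //.
  by case: ifP.
have rpe j : phi j (e ord0) = e j by rewrite -[in RHS]re ffunE.
have rpf j : phi j (f ord0) = f j by rewrite -[in RHS]rf ffunE.
rewrite !addnA => /addIn ->.
case: (eqVneq i ord0) => [i0|i0].
  (* Exchanging all coordinates but 0 makes the two new edges appear in the opposite order. *)
  rewrite addnC; congr (nat_of_bool (_ \in G) + nat_of_bool (_ \in G));
    apply/ffunP=> j; rewrite !ffunE /phi' /h i0 eqxx eqb_id ?tpermL ?tpermR rpe rpf;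
    by case: (eqVneq j _) => // ->.
congr (nat_of_bool (_ \in G) + nat_of_bool (_ \in G));
  apply/ffunP=> j; rewrite !ffunE /phi' /h (negPf i0) eqbF_neg ?tpermL ?tpermR rpe rpf;
  by case: (eqVneq j i) => // ->.
Qed.

Lemma relevant_disj (e f : edge) i :
    e \in G -> f \in edges V -> setc e i (f i) \notin G -> disj e f ->
  f \notin G /\ setc f i (e i) \in G.
Proof.
move=> eG fE eyG ef.
have := swap_coordinate i (subsetP G_edges _ eG) fE ef.
by rewrite eG (negPf eyG); case: (f \in G); case: (_ \in G).
Qed.

(** The value [f i] alone thus excludes an edge from [G]. An intermediate edge [h], which agrees
    with [f] in coordinate [i] only and is disjoint from [e], reduces this to two exchanges between
    disjoint edges. *)
Lemma relevant_all (e f : edge) i :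
    e \in G -> f \in edges V -> setc e i (f i) \notin G ->
  f \notin G /\ setc f i (e i) \in G.
Proof.
move=> eG fE eyG.
have eE := subsetP G_edges _ eG.
have eV := edgesP _ _ eE; have fV := edgesP _ _ fE.
have ei : e i != f i by apply: contraNneq eyG => <-; rewrite setc_id.
(* Each part has more than two vertices, so the default [e j] is never taken. *)
have [z zP] : exists z : 'I_r.+1 -> T, forall j, z j \in V j :\: [set e j; f j].
  exists (fun j => odflt (e j) [pick z in V j :\: [set e j; f j]]) => j.
  case: pickP => //= no.
  have : #|V j| <= #|[set e j; f j]|.
    apply: subset_leq_card; apply/subsetP=> z zV.
    by have := no z; rewrite inE zV andbT => /negbFE.
  by rewrite cards2; have := V0min j; case: (_ != _); lia.
pose h : edge := [ffun j => if j == i then f i else z j].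
have hi : h i = f i by rewrite ffunE eqxx.
have hE : h \in edges V.
  apply/edgesP=> j; rewrite ffunE; case: (eqVneq j i) => [->//|_].
  by have /setDP[] := zP j.
have eh : disj e h.
  apply/forallP=> j; rewrite ffunE; case: (eqVneq j i) => [->//|_].
  by have := zP j; rewrite !inE negb_or eq_sym => /andP[/andP[]].
have [|hG hG'] := @relevant_disj e h i eG hE _ eh; first by rewrite hi.
have := @relevant_disj (setc h i (e i)) f i hG' fE.
rewrite setc_setc setc_at -hi setc_id; apply=> //.
apply/forallP=> j; rewrite !ffunE; case: (eqVneq j i) => [->//|_].
by have := zP j; rewrite !inE negb_or => /andP[/andP[]].
Qed.

Definition relevant i :=
  [exists e in G, exists y in V i, setc e i y \notin G].

(** Take an edge of [G], give coordinate [j] its excluding value [y'] and coordinate [i] its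
    excluding value [y]. Restoring coordinate [i] leads back into [G], although the value [y'] at
    [j] forbids it. *)
Lemma relevant_unique i j : relevant i -> relevant j -> i = j.
Proof.
case/exists_inP=> e eG /exists_inP[y yV ny].
case/exists_inP=> e' e'G /exists_inP[y' y'V ny'].
apply/eqP/negPn/negP => ij.
have eE := subsetP G_edges _ eG.
pose f := setc (setc e j y') i y.
have fE : f \in edges V by do 2!apply: setc_edges => //.
have [|_ fG] := @relevant_all e f i eG fE; first by rewrite setc_at.
have gE := subsetP G_edges _ fG.
have gj : setc f i (e i) j = y' by rewrite !ffunE [j == i]eq_sym (negPf ij) eqxx.
have [] := @relevant_all e' (setc f i (e i)) j e'G gE; first by rewrite gj.
by rewrite fG.
Qed.

(** The coordinates of [e] are replaced by those of [f] one at a time; no step leaves [G]. *)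
Lemma irrelevant_transfer (e f : edge) :
    e \in G -> f \in edges V -> (forall j, relevant j -> e j = f j) -> f \in G.
Proof.
move=> eG /edgesP fV ef.
pose mix s : edge := [ffun j : 'I_r.+1 => if j < s then f j else e j].
have mixG s : s <= r.+1 -> mix s \in G.
  elim: s => [_|s IH sr].
    by rewrite (_ : mix 0 = e) //; apply/ffunP=> j; rewrite ffunE.
  have mG := IH (ltnW sr); pose j : 'I_r.+1 := Ordinal sr.
  have Emix : mix s.+1 = setc (mix s) j (f j).
    apply/ffunP=> l; rewrite !ffunE ltnS leq_eqVlt.
    case: (eqVneq l j) => [->|lj]; first by rewrite eqxx.
    by rewrite -[_ == s]/(l == j) (negPf lj).
  rewrite Emix; case: (boolP (relevant j)) => [/ef Ej|].
    by rewrite -[f j]Ej (_ : e j = mix s j) ?setc_id // ffunE ltnn.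
  rewrite negb_exists_in => /forall_inP/(_ _ mG).
  by rewrite negb_exists_in => /forall_inP/(_ _ (fV j)); rewrite negbK.
rewrite (_ : f = mix r.+1) ?mixG //.
by apply/ffunP=> j; rewrite ffunE ltn_ord.
Qed.

Lemma relevant_exists : exists i, relevant i.
Proof.
have [phi Tphi] := transv_exists V0min.
have cphi := G_regular Tphi.
have [e eGs] : exists e, e \in G :&: slice V 1 phi.
  by apply/set0Pn; rewrite -card_gt0 cphi; case/andP: m_bounds.
have [f] : exists f, f \in slice V 1 phi :\: G.
  by apply/set0Pn; rewrite -card_gt0 cardsD setIC cphi card_slice1 //; lia.
case/setDP=> /(subsetP (slice_edges _ _ _)) fE fG; case/setIP: eGs => eG _.
have [/existsP//|] := boolP [exists i, relevant i].
rewrite negb_exists => /forallP no; case/negP: fG.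
by apply: irrelevant_transfer eG fE _ => j rj; case/negP: (no j).
Qed.

Lemma regular_star : exists i (W : {set T}),
  [/\ W \subset V i, #|W| = m, #|V i| = #|V0| &
      {in edges V, forall f, (f \in G) = (f i \in W)}].
Proof.
have [i ri] := relevant_exists.
pose W := [set (f : edge) i | f in G]; exists i, W.
have GW : {in edges V, forall f, (f \in G) = (f i \in W)}.
  move=> f fE; apply/idP/imsetP=> [fG|[g gG Eg]]; first by exists f.
  by apply: irrelevant_transfer gG fE _ => j /relevant_unique/(_ ri)->.
have WV : W \subset V i.
  by apply/subsetP=> y /imsetP[f /(subsetP G_edges)/edgesP fV ->].
have sumW phi : transv V phi -> \sum_(x in V0) (phi i x \in W) = m.
  move=> Tphi; rewrite -(G_regular Tphi) card_slice1_sum //.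
  apply: eq_bigr => x xV; rewrite GW ?ffunE //.
  exact: subsetP (slice_edges _ 1 _) _ (row_slice _ Tphi xV).
have [phi Tphi] := transv_exists V0min.
have [p0 pV pI] := Tphi.
(* If [phi i] missed a point [z] of [V i], redirecting to [z] some [x] whose image differs from [z]
   in membership of [W] would change the constant count [m]. Such an [x] exists because
   [0 < m < #|V0|]. *)
have surj : phi i @: V0 = V i.
  apply/eqP; rewrite eqEsubset; apply/andP; split.
    by apply/subsetP=> y /imsetP[x xV ->]; apply: pV.
  apply/subsetP=> z zV; apply/negPn/negP => zim.
  have [x xV nx] : exists2 x, x \in V0 & (phi i x \in W) != (z \in W).
    have [/exists_inP//|] :=
      boolP [exists x in V0, (phi i x \in W) != (z \in W)].
    rewrite negb_exists_in => /forall_inP no; have := sumW _ Tphi.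
    rewrite (eq_bigr (fun=> nat_of_bool (z \in W))).
      by rewrite sum_nat_const; case: (z \in W); lia.
    by move=> x /no; rewrite negbK => /eqP->.
  have i0 : 0 < i.
    rewrite lt0n; apply: contraNneq zim => i0.
    have Ei : i = ord0 by apply: val_inj.
    have zV0 : z \in V0 by rewrite -Ei.
    by rewrite Ei; apply/imsetP; exists z; rewrite ?p0.
  have Tx : transv V (upd phi i (fun u => if u == x then z else phi i u)).
    apply: transv_upd => // [u uV|u v uV vV].
      by case: ifP => // _; apply: pV.
    have nz w : w \in V0 -> z <> phi i w.
      by move=> wV E; case/negP: zim; rewrite E; apply: imset_f.
    case: eqP => [->|_]; case: eqP => [->//|_] //.
    - by move/nz.
    - by move/esym/nz.
    - exact: pI.
  have := sumW _ Tx; rewrite -(sumW _ Tphi) !(bigD1 x xV) /= /upd !eqxx.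
  rewrite [X in _ + X = _](eq_bigr (fun u => nat_of_bool (phi i u \in W))).
    by move/addIn=> E; case/eqP: nx; move: E; do 2!case: (_ \in W).
  by move=> u /andP[_ /negPf->].
split=> //; last by rewrite -surj card_in_imset //; apply: pI.
have -> : W = phi i @: [set x in V0 | phi i x \in W].
  apply/setP=> y; apply/idP/imsetP=> [yW|[x]]; last by rewrite inE => /andP[_ xW] ->.
  have := subsetP WV y yW; rewrite -surj => /imsetP[x xV Ey].
  by exists x => //; rewrite inE xV -Ey.
rewrite card_in_imset; last first.
  by move=> x y; rewrite !inE => /andP[xV _] /andP[yV _]; apply: pI.
rewrite -(sumW _ Tphi) -sum1dep_card [RHS]big_mkcond [LHS]big_mkcond.
by apply: eq_bigr => x _; case: (x \in V0) => //=; case: (_ \in W).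
Qed.

End Extremal.

(** * The structure of colourings that attain the bound *)

Section ExtremalColorings.

Variables (r : nat) (T : finType) (V : 'I_r.+1 -> {set T}).

Local Notation V0 := (V ord0).
Local Notation edge := {ffun 'I_r.+1 -> T}.

Hypothesis r_gt0 : 0 < r.
Hypothesis V0min : forall i, #|V0| <= #|V i|.

Variable k : nat.
Hypothesis k_gt2 : 2 < k.
Hypothesis V0k : 2 * k - 1 <= #|V0|.

Variables (C : finType) (c : edge -> C).
Hypothesis no_rainbow : forall M : {set edge}, M \subset edges V ->
  fmatching M -> {in M &, injective c} -> #|M| < k.

Lemma colors_leq : #|c @: edges V| <= ((k - 2) * slice_deg V r.+1).+1.
Proof.
have [phi Tphi] := transv_exists V0min.
by rewrite -(slice_full V phi); apply: colors_slice_leq; rewrite ?leqnn.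
Qed.

Lemma extremal_coloring :
    #|c @: edges V| = ((k - 2) * slice_deg V r.+1).+1 ->
  exists a i (W : {set T}),
    [/\ W \subset V i, #|W| = k - 2, #|V i| = #|V0|,
        {in edges V, forall f, (c f != a) = (f i \in W)} &
        {in edges V &, forall f g, c f = c g -> f i \in W -> f = g}].
Proof.
move=> cmax.
have [phi Tphi] := transv_exists V0min.
have [|a aP] := colors_slice_unique k_gt2 no_rainbow V0min V0k _ Tphi
  (etrans (congr1 (fun A : {set edge} => #|c @: A|) (slice_full V phi)) cmax).
  by rewrite leqnn andbT.
rewrite slice_full in aP.
pose G := [set f in edges V | c f != a].
have GE : G \subset edges V by apply/subsetP=> f /setIdP[].
have cG : {in G &, injective c}.
  by move=> f g /setIdP[fE cf] /setIdP[gE _] cfg; apply: aP.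
(* An edge disjoint from [k - 1] edges of [G] would repeat one of their colours, but the colours on
   [G] occur only once. *)
have Gle phi' : transv V phi' -> #|G :&: slice V 1 phi'| <= k - 2.
  move=> Tphi'; rewrite leqNgt; apply/negP => /subset_of_card[R RG Rk].
  have RsG : R \subset G := subset_trans RG (subsetIl _ _).
  have RE : R \subset edges V := subset_trans RsG GE.
  have [x] : exists x, x \in V0 :\: [set (f : edge) ord0 | f in R].
    apply/set0Pn; rewrite -card_gt0 cardsD subn_gt0.
    apply: leq_ltn_trans (subset_leq_card (subsetIr _ _)) _.
    apply: leq_ltn_trans (leq_imset_card _ _) _.
    by rewrite Rk; lia.
  case/setDP=> xV xR.
  (* At level [r.+1] no coordinate is tied, so only the first coordinate needs an explicit
     choice. *)
  have [|||g gE gR] := @slice_avoid _ _ _ V0min r.+1 _ R x Tphi xV.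
  - by rewrite Rk; lia.
  - move=> f fR; apply: contraNneq xR => <-.
    exact: (imset_f (fun f : edge => f ord0)).
  - by move=> f _ i; rewrite leqNgt ltn_ord.
  rewrite slice_full in gE.
  have : c g \in c @: R.
    apply: (color_of_avoiding k_gt2 no_rainbow) => //.
    - apply: fmatching_sub (slice1_matching Tphi').
      exact: subset_trans RG (subsetIr _ _).
    - by move=> f h fR hR; apply: cG; apply: (subsetP RsG).
    - by rewrite Rk; lia.
  case/imsetP=> f fR cgf.
  have fE := subsetP RE f fR.
  have /setIdP[_ cfa] := subsetP RsG f fR.
  have := gR f fR; rewrite (aP f g) //.
  by move/forallP/(_ ord0); rewrite eqxx.
have sr : 0 < r.+1 <= r.+1 by rewrite leqnn.
have Gcard : #|G :&: slice V r.+1 phi| = (k - 2) * slice_deg V r.+1.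
  apply/eqP; rewrite eqn_leq slice_leq //=; last by lia.
  rewrite slice_full (setIidPl GE) -(card_in_imset cG).
  have : c @: edges V \subset a |: c @: G.
    apply/subsetP=> _ /imsetP[f fE ->]; rewrite inE inE.
    case: (eqVneq (c f) a) => //= cfa; apply: imset_f.
    exact/setIdP.
  move/subset_leq_card; rewrite cmax cardsU1.
  by move=> h; rewrite -ltnS (leq_trans h) // (leq_add (leq_b1 _) (leqnn _)).
have Greg phi' : transv V phi' -> #|G :&: slice V 1 phi'| = k - 2.
  move=> Tphi'; apply: (slice_eq V0min _ Gle sr Tphi Gcard Tphi') => [|i].
    by lia.
  by rewrite leqNgt ltn_ord.
have [||i [W [WV Wk Vi GW]]] := regular_star V0min _ _ GE Greg; [lia|lia|].
exists a, i, W; split=> // [f fE|f g fE gE cfg fW].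
  by rewrite -GW // inE fE.
by apply: aP => //; rewrite -GW // inE fE in fW.
Qed.

End ExtremalColorings.

(** * From choice functions to vertex sets *)

Section VertexSets.

Variables (r : nat) (T : finType).

Local Notation edge := {ffun 'I_r.+1 -> T}.

Implicit Types (V : 'I_r.+1 -> {set T}) (W : {set T}) (f g : edge).

Definition vset f : {set T} := [set f i | i : 'I_r.+1].

Lemma part_inj V i j x :
  pairwise_disjoint V -> x \in V i -> x \in V j -> i = j.
Proof.
move=> VD xi xj; apply/eqP/negPn/negP => /VD/pred0P/(_ x).
by rewrite /= xi xj.
Qed.

Lemma vset_meet V f i : pairwise_disjoint V -> f \in edges V ->
  vset f :&: V i = [set f i].
Proof.
move=> VD /edgesP fV; apply/setP=> x; rewrite in_setI in_set1.
apply/andP/eqP => [[/imsetP[j _ ->]] fji|->].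
  by rewrite (part_inj VD (fV j) fji).
by split=> //; apply: imset_f.
Qed.

Lemma vset_partite V f : pairwise_disjoint V -> f \in edges V ->
  vset f \in complete_partite V.
Proof.
move=> VD fE; rewrite inE; apply/andP; split.
  rewrite card_imset ?card_ord // => i j fij.
  by have /edgesP fV := fE; apply: (part_inj VD (fV i)); rewrite fij.
by apply/forallP=> i; rewrite (vset_meet _ VD fE) cards1.
Qed.

Lemma partite_vset V S : pairwise_disjoint V -> S \in complete_partite V ->
  exists2 f, f \in edges V & S = vset f.
Proof.
move=> VD; rewrite inE => /andP[/eqP Sr /forallP SV].
have [y yP] : exists y : 'I_r.+1 -> T, forall i, y i \in S :&: V i.
  have [x0 _] : exists x, x \in S by apply/set0Pn; rewrite -card_gt0 Sr.
  exists (fun i => odflt x0 [pick z in S :&: V i]) => i.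
  case: pickP => //= no; have := SV i.
  by rewrite (eq_card0 no).
have fE : finfun y \in edges V.
  by apply/edgesP=> i; rewrite ffunE; have /setIP[] := yP i.
exists (finfun y) => //; apply/esym/eqP; rewrite eqEcard Sr.
have := vset_partite VD fE; rewrite inE => /andP[/eqP-> _]; rewrite leqnn andbT.
by apply/subsetP=> _ /imsetP[i _ ->]; rewrite ffunE; have /setIP[] := yP i.
Qed.

Lemma vset_inj V : pairwise_disjoint V -> {in edges V &, injective vset}.
Proof.
move=> VD f g fE gE E; apply/ffunP=> i; apply: set1_inj.
by rewrite -(vset_meet i VD fE) -(vset_meet i VD gE) E.
Qed.

Lemma vset_disjoint V f g : pairwise_disjoint V -> f \in edges V ->
  g \in edges V -> disj f g -> [disjoint vset f & vset g].
Proof.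
move=> VD /edgesP fV /edgesP gV /forallP fg; apply/pred0P=> x /=.
apply/negP => /andP[/imsetP[i _ ->] /imsetP[j _ E]].
have ij : i = j by apply: (part_inj VD (fV i)); rewrite E.
by have := fg i; rewrite {2}ij E eqxx.
Qed.

Lemma complete_partiteE V : pairwise_disjoint V ->
  complete_partite V = vset @: edges V.
Proof.
move=> VD; apply/setP=> S; apply/idP/imsetP=> [/(partite_vset VD)[f]|[f fE ->]].
  by exists f.
exact: vset_partite.
Qed.

Lemma card_edges V : #|edges V| = \prod_i #|V i|.
Proof.
have -> : #|edges V| = #|family (fun i => mem (V i))|.
  by apply: eq_card => f; rewrite inE; apply: eq_forallb.
by rewrite card_family foldrE big_map big_enum.
Qed.

(* The part of size k - 2 has index 0 in type_phi, so the parts 0 and i are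
   exchanged. *)
Definition star_parts V i W j :=
  if j == ord0 then W else V (tperm ord0 i j).

Lemma star_parts_sub V i W j :
  W \subset V i -> star_parts V i W j \subset V (tperm ord0 i j).
Proof. by rewrite /star_parts; case: eqP => [->|]; rewrite ?tpermL. Qed.

Lemma star_parts_disjoint V i W : pairwise_disjoint V -> W \subset V i ->
  pairwise_disjoint (star_parts V i W).
Proof.
move=> VD WV j l jl.
apply: disjointWl (star_parts_sub j WV) _.
apply: disjointWr (star_parts_sub l WV) _.
by apply: VD; rewrite (inj_eq perm_inj).
Qed.

Lemma star_partite V i W : pairwise_disjoint V -> W \subset V i ->
  complete_partite (star_parts V i W) =
  vset @: [set f in edges V | f i \in W].
Proof.
move=> VD WV; rewrite complete_partiteE; last exact: star_parts_disjoint.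
pose s := tperm ord0 i.
have vs f : vset [ffun j => f (s j)] = vset f.
  apply/setP=> x; apply/imsetP/imsetP=> -[j _ ->].
    by exists (s j) => //; rewrite ffunE.
  by exists (s j) => //; rewrite ffunE tpermK.
apply/setP=> S; apply/imsetP/imsetP=> -[f].
  move=> /edgesP fE ->; exists [ffun j => f (s j)]; last by rewrite vs.
  rewrite inE ffunE /s tpermR.
  have := fE ord0; rewrite /star_parts eqxx => ->; rewrite andbT.
  apply/edgesP=> j; rewrite ffunE; have := fE (s j).
  by move/(subsetP (star_parts_sub _ WV)); rewrite tpermK.
rewrite inE => /andP[/edgesP fE fW] ->.
exists [ffun j => f (s j)]; last by rewrite vs.
apply/edgesP=> j; rewrite ffunE /star_parts.
by case: eqP => [->|_]; rewrite ?/s ?tpermL.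
Qed.

End VertexSets.

Arguments vset {r T} f.

(** * Decidability of rainbow matchings and colours in a finite type *)

Section RainbowSets.

Variables (T : finType) (G : {set {set T}}) (k : nat) (c : {set T} -> nat).

(** The boolean form permits a case distinction on the existence of a rainbow matching. *)
Lemma has_rainbowP :
  reflect (has_rainbow G (matching k) c)
    [exists M : {set {set T}}, [&& M \subset G, #|M| == k, trivIset M &
       [forall e in M, forall f in M, (c e == c f) ==> (e == f)]]].
Proof.
apply: (iffP existsP) => -[M].
  case/and4P=> MG /eqP Mk Mt /forall_inP Mi; exists M; split=> // e f eM fM cef.
  by apply/eqP; have := forall_inP (Mi e eM) f fM; rewrite cef eqxx.
case=> MG [Mk Mt] Mi; exists M; rewrite MG Mk eqxx Mt /=.
apply/forall_inP=> e eM; apply/forall_inP=> f fM; apply/implyP=> /eqP cef.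
by apply/eqP; apply: Mi.
Qed.

Definition max_color := \max_(S : {set T}) c S.

(** The same colouring with values in a finite type, where colours can be counted as an image
    set. *)
Definition ord_color S : 'I_max_color.+1 := inord (c S).

Lemma ord_colorE S : ord_color S = c S :> nat.
Proof. by rewrite inordK // ltnS (leq_bigmax_cond (F := c)). Qed.

Lemma n_colorsE : n_colors G c = #|ord_color @: G|.
Proof.
have -> : #|ord_color @: G| = size (undup [seq ord_color e | e in G]).
  rewrite -(card_uniqP (undup_uniq _)); apply: eq_card => x.
  by rewrite mem_undup; apply/imsetP/imageP=> -[e]; exists e.
rewrite -(size_map val) -undup_map_inj; last by move=> *; apply: val_inj.
by rewrite -map_comp; congr (size (undup _)); apply: eq_map => S /=; rewrite ord_colorE.
Qed.

End RainbowSets.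

(** * The bounds for the complete multipartite hypergraph and the extremal colouring *)

Section AntiRamsey.

Variables (r : nat) (T : finType) (V : 'I_r.+1 -> {set T}) (k : nat).

Local Notation V0 := (V ord0).
Local Notation edge := {ffun 'I_r.+1 -> T}.

Hypothesis r_gt0 : 0 < r.
Hypothesis VD : pairwise_disjoint V.
Hypothesis V0min : forall i, #|V0| <= #|V i|.
Hypothesis k_gt2 : 2 < k.
Hypothesis V0k : 2 * k - 1 <= #|V0|.

Lemma no_rainbow_edges c : ~ has_rainbow (complete_partite V) (matching k) c ->
  forall M : {set edge}, M \subset edges V -> fmatching M ->
  {in M &, injective (fun f => ord_color c (vset f))} -> #|M| < k.
Proof.
move=> nr M ME Mm Mi; rewrite ltnNge; apply/negP => /subset_of_card[R RM Rk].
have RE := subset_trans RM ME.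
apply: nr; exists (vset @: R); split.
- by rewrite complete_partiteE // imsetS.
- split; first by rewrite card_in_imset // => f g fR gR;
    apply: (vset_inj VD); apply: (subsetP RE).
  apply/trivIsetP=> _ _ /imsetP[f fR ->] /imsetP[g gR ->] fg.
  apply: (vset_disjoint VD); try exact: (subsetP RE).
  by apply: Mm; try exact: (subsetP RM); apply: contraNneq fg => ->.
move=> _ _ /imsetP[f fR ->] /imsetP[g gR ->] cfg; congr vset.
by apply: Mi; try exact: (subsetP RM); apply: val_inj; rewrite /= !ord_colorE.
Qed.

Lemma n_colors_edges c : n_colors (complete_partite V) c =
  #|[set ord_color c (vset f) | f in edges V]|.
Proof. by rewrite n_colorsE complete_partiteE // -imset_comp. Qed.

Lemma n_colors_leq c : ~ has_rainbow (complete_partite V) (matching k) c ->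
  n_colors (complete_partite V) c <= (k - 2) * slice_deg V r.+1 + 1.
Proof.
by move=> nr; rewrite n_colors_edges addn1; apply: colors_leq => //;
  apply: no_rainbow_edges.
Qed.

Lemma n_colors_type_phi c : ~ has_rainbow (complete_partite V) (matching k) c ->
  n_colors (complete_partite V) c = (k - 2) * slice_deg V r.+1 + 1 ->
  type_phi k V c.
Proof.
move=> nr; rewrite n_colors_edges addn1 => cmax.
have [a [i [W [WV Wk Vi cW cI]]]] :=
  extremal_coloring r_gt0 V0min k_gt2 V0k (no_rainbow_edges nr) cmax.
exists (star_parts V i W); rewrite star_partite //; split.
- exact: star_parts_disjoint.
- move=> j; rewrite /star_parts -val_eqE /=; case: ifP => // j0.
  by case: tpermP => [->|->|] //; rewrite Vi.
- by rewrite complete_partiteE //; apply: imsetS; apply/subsetP=> f /setIdP[].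
- move=> _ _ /imsetP[f /setIdP[fE fW] ->] /imsetP[g /setIdP[gE gW] ->] cfg.
  by congr vset; apply: cI => //; apply: val_inj; rewrite /= !ord_colorE.
exists a; split.
  move=> _ /imsetP[f /setIdP[fE fW] ->] cfa.
  have := cW f fE; rewrite fW => /eqP[]; apply: val_inj.
  by rewrite /= ord_colorE.
move=> S; rewrite complete_partiteE // => /setDP[/imsetP[f fE ->]] nW.
have /negbT/negPn/eqP <- : (ord_color c (vset f) != a) = false.
  rewrite cW //; apply: contraNF nW => fW; apply: imset_f.
  exact/setIdP.
by rewrite ord_colorE.
Qed.

(** The successor keeps the private colours of the sets that meet [W] apart from the common colour
    0. *)
Definition star_coloring (W : {set T}) (S : {set T}) : nat :=
  if S :&: W == set0 then 0 else (enum_rank S).+1.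

(** At most [#|W| = k - 2] pairwise disjoint sets meet [W], and a rainbow family has at most one set
    of colour 0, so it falls short of [k]. *)
Lemma star_coloring_rainbow (W : {set T}) (G : {set {set T}}) :
  #|W| = k - 2 -> ~ has_rainbow G (matching k) (star_coloring W).
Proof.
move=> Wk [M [_ [Mk /trivIsetP Mt] Mi]].
pose M1 := [set S in M | S :&: W != set0].
have M1W : #|M1| <= #|W|.
  have [->|[S0 S0M]] := set_0Vmem M1; first by rewrite cards0.
  have [x0 _] : exists x, x \in S0 :&: W.
    by apply/set0Pn; case/setIdP: S0M.
  pose g S := odflt x0 [pick x in S :&: W].
  have gP S : S \in M1 -> g S \in S :&: W.
    case/setIdP=> _ /set0Pn[x xS]; rewrite /g.
    by case: pickP => //= /(_ x); rewrite xS.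
  rewrite -(@card_in_imset _ _ g M1).
    apply: subset_leq_card; apply/subsetP=> _ /imsetP[S /gP/setIP[_ gW] ->] //.
  move=> S S' SM S'M gE; apply/eqP/negPn/negP => SS'.
  have /setIdP[SM' _] := SM; have /setIdP[S'M' _] := S'M.
  have /pred0P/(_ (g S)) := Mt _ _ SM' S'M' SS'.
  have /setIP[gS _] := gP _ SM; have /setIP[gS' _] := gP _ S'M.
  by rewrite /= gS gE gS'.
have M2 : #|M :\: M1| <= 1.
  apply/card_le1_eqP => S S' /setDP[SM SM1] /setDP[S'M S'M1].
  have z P : P \in M -> P \notin M1 -> star_coloring W P = 0.
    by move=> PM; rewrite inE PM /= negbK /star_coloring => ->.
  by apply: Mi => //; rewrite !z.
have := cardsID M1 M; rewrite (setIidPr _) ?Mk; first by lia.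
by apply/subsetP=> S /setIdP[].
Qed.

Lemma slice_deg_full : slice_deg V r.+1 = \prod_(i < r) #|V (lift ord0 i)|.
Proof.
rewrite /slice_deg big_mkcond big_ord_recl /= mul1n.
by apply: eq_bigr => i _; rewrite /= ltnS ltn_ord.
Qed.

Lemma star_coloring_exists : exists c,
  n_colors (complete_partite V) c = (k - 2) * slice_deg V r.+1 + 1 /\
  ~ has_rainbow (complete_partite V) (matching k) c.
Proof.
have [|W WV Wk] := @subset_of_card _ V0 (k - 2); first by lia.
pose c := star_coloring W; exists c.
have nr : ~ has_rainbow (complete_partite V) (matching k) c.
  exact: star_coloring_rainbow.
split=> //; apply/eqP; rewrite eqn_leq n_colors_leq //=.
(* The upper bound is known, so enough distinct colours must be exhibited: one for each edge with
   first coordinate in [W], and the colour 0 of an edge [f0] that misses [W]. *)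
pose P j := if j == ord0 then W else V j.
have PV : edges P \subset edges V.
  apply/subsetP=> f /edgesP fP; apply/edgesP=> j; have := fP j.
  by rewrite /P; case: eqP => // ->; apply: (subsetP WV).
have cP f : f \in edges P -> c (vset f) = (enum_rank (vset f)).+1.
  move=> fP; rewrite /c /star_coloring; case: eqP => // /setP/(_ (f ord0)).
  have /edgesP/(_ ord0) := fP; rewrite /P eqxx !inE => ->.
  by rewrite (imset_f (fun i => f i)).
have [f0 f0V f0W] : exists2 f0, f0 \in edges V & f0 ord0 \notin W.
  have [phi Tphi] := transv_exists V0min.
  have [x] : exists x, x \in V0 :\: W.
    by apply/set0Pn; rewrite -card_gt0 cardsD (setIidPr WV) Wk; lia.
  case/setDP=> xV xW; exists (row phi x).
    exact: subsetP (slice_edges _ 1 _) _ (row_slice _ Tphi xV).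
  by rewrite ffunE; have [->] := Tphi.
have cf0 : c (vset f0) = 0.
  rewrite /c /star_coloring; case: eqP => // /eqP/set0Pn[x /setIP[xf xW]].
  have : x \in vset f0 :&: V0 by rewrite inE xf (subsetP WV).
  by rewrite (vset_meet _ VD f0V) inE => /eqP xf0; rewrite -xf0 xW in f0W.
have -> : (k - 2) * slice_deg V r.+1 = #|edges P|.
  rewrite card_edges big_ord_recl slice_deg_full /P eqxx Wk.
  by congr (_ * _); apply: eq_bigr.
pose s := c (vset f0) :: [seq c (vset f) | f <- enum (edges P)].
have -> : #|edges P| + 1 = size s by rewrite /= size_map -cardE addn1.
apply: uniq_leq_size.
  rewrite /= map_inj_in_uniq ?enum_uniq.
    rewrite andbT; apply/mapP=> -[f]; rewrite mem_enum => fP.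
    by rewrite cf0 cP.
  move=> f g; rewrite !mem_enum => fP gP.
  rewrite !cP // => -[/val_inj/enum_rank_inj].
  by apply: (vset_inj VD); apply: (subsetP PV).
have all f : f \in edges V ->
    c (vset f) \in undup [seq c e | e in complete_partite V].
  move=> fV; rewrite mem_undup; apply: image_f.
  exact: vset_partite.
move=> y; rewrite inE => /predU1P[->|/mapP[f]]; first exact: all.
by rewrite mem_enum => fP ->; apply: all; apply: (subsetP PV).
Qed.

End AntiRamsey.

(* n 0, ..., n (r - 1) are the part sizes n_1, ..., n_r. *)
Theorem theorem1p8 (r k : nat) (n : nat -> nat)
    (T : finType) (V : 'I_r -> {set T}) :
  2 <= r -> 3 <= k ->
  (forall i : nat, i.+1 < r -> n i <= n i.+1) ->
  2 * k - 1 <= n 0 ->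
  pairwise_disjoint V ->
  (forall i : 'I_r, #|V i| = n i) ->
  is_ar (complete_partite V) (matching k)
    ((k - 2) * \prod_(1 <= i < r) n i + 1) /\
  (forall c : {set T} -> nat,
     n_colors (complete_partite V) c = (k - 2) * \prod_(1 <= i < r) n i + 1 ->
     ~ type_phi k V c ->
     has_rainbow (complete_partite V) (matching k) c).
Proof.
case: r V => // r V r_gt0 k_gt2 nS n0 VD Vn.
have V0k : 2 * k - 1 <= #|V ord0| by rewrite Vn.
have V0min i : #|V ord0| <= #|V i|.
  rewrite !Vn; case: i => i /=; elim: i => // i IH ir.
  by apply: leq_trans (IH (ltnW ir)) _; apply: nS.
have -> : \prod_(1 <= i < r.+1) n i = slice_deg V r.+1.
  rewrite slice_deg_full big_add1 big_mkord.
  by apply: eq_bigr => i _; rewrite Vn.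
split; first split.
- exact: star_coloring_exists.
- by move=> c; apply: n_colors_leq.
move=> c cmax nphi.
have [//|nr] := has_rainbowP (complete_partite V) k c.
by case: nphi; apply: n_colors_type_phi.
Qed.
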